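(* Let $(S_n)_{n\ge1}$ be a demisubmartingale. Then, for every $n\ge1$ and every $\lambda>0$, $$P\left(\min_{1\le k\le n}S_k\le-\lambda\right)\le\frac{E(S_n^+)-E(S_1)}{\lambda}.$$
   Context: $x^+=\max\{0,x\}$. Functions are understood to be Borel measurable. A sequence of $L^1$ random variables $(S_n)_{n\ge1}$ is a demisubmartingale if for all $j\ge1$, $E[(S_{j+1}-S_j)f(S_1,\ldots,S_j)]\ge 0$ for all nonnegative componentwise nondecreasing functions $f:\mathbb{R}^j\to\mathbb{R}$ for which the expectation is defined. *)

(* Defs.v *)
From HB Require Import structures.
From mathcomp Require Import all_boot all_order all_algebra.
From mathcomp Require Import all_classical all_reals all_analysis.

Set Implicit Arguments.
Unset Strict Implicit.
Unset Printing Implicit Defensive.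

Import Order.TTheory GRing.Theory Num.Theory.
Import numFieldNormedType.Exports.

Local Open Scope classical_set_scope.
Local Open Scope ring_scope.
Local Open Scope ereal_scope.

(* The library's 'E_P[X] is total, so the requirement that the expectation is
   defined (as an extended real number) is explicit: the positive and negative
   parts do not both have infinite expectation. *)
Definition expectation_defined (d : measure_display) (T : measurableType d)
    (R : realType) (P : probability T R) (X : T -> R) : Prop :=
  'E_P[X^\+] < +oo \/ 'E_P[X^\-] < +oo.

Definition componentwise_nondecreasing (R : realType) (j : nat)
    (f : j.-tuple R -> R) : Prop :=
  forall x y : j.-tuple R,
    (forall i : 'I_j, (tnth x i <= tnth y i)%R) -> (f x <= f y)%R.

(* Sequences are indexed from 1 as S 1, S 2, ...; the value S 0 is irrelevant.
   The sigma-algebra on j.-tuple R is generated by the coordinate maps, i.e.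
   it is the Borel sigma-algebra of R^j. *)
Definition demisubmartingale (d : measure_display) (T : measurableType d)
    (R : realType) (P : probability T R) (S : nat -> {RV P >-> R}) : Prop :=
  (forall n : nat, (1 <= n)%N -> (S n : T -> R) \in Lfun P 1) /\
  forall j : nat, (1 <= j)%N ->
  forall f : j.-tuple R -> R,
    measurable_fun [set: j.-tuple R] f ->
    (forall x, (0 <= f x)%R) ->
    componentwise_nondecreasing f ->
    let X w := ((S j.+1 w - S j w) * f [tuple S i.+1 w | i < j])%R in
    expectation_defined P X -> 0 <= 'E_P[X].

(* Main.v *)
Require Import Defs.
From HB Require Import structures.
From mathcomp Require Import all_boot all_order all_algebra.
From mathcomp Require Import all_classical all_reals all_analysis.
From mathcomp Require Import measurable_realfun lra.

Import Order.TTheory GRing.Theory Num.Theory.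
Import numFieldNormedType.Exports.

Local Open Scope classical_set_scope.
Local Open Scope ring_scope.
Local Open Scope ereal_scope.

(** Stop the sequence at the first time it falls to [- lambda] or below. The
    indicator [I_j] of the event that [S_1, ..., S_j] all exceed [- lambda] is a
    nonnegative nondecreasing function of [(S_1, ..., S_j)], so the
    demisubmartingale property gives [E[(S_{j+1} - S_j) I_j] >= 0]
    ([expectation_stopped_increment_ge0]). Summing these inequalities shows that
    the stopped variable [Y_n = S_1 + sum_{j < n} (S_{j+1} - S_j) I_j] satisfies
    [E S_1 <= E Y_n] ([le_expectation_stopped]).

    On the event [B] that the minimum is at most [- lambda], the path has been
    stopped by time [n], hence [Y_n <= - lambda] ([stopped_le]); off [B] nothing
    has been stopped and [Y_n = S_n] ([stopped_above]). Therefore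
    [Y_n <= S_n^+ - lambda 1_B] everywhere, and taking expectations yields
    [E S_1 <= E S_n^+ - lambda P(B)], which is the claim. *)

Set Implicit Arguments.
Unset Strict Implicit.
Unset Printing Implicit Defensive.

(** The vectors of [R^j] all of whose coordinates exceed [a]. *)
Definition above (R : realType) (a : R) (j : nat) : set (j.-tuple R) :=
  [set x | forall i, (a < tnth x i)%R].
Arguments above {R} a j _.

(** The vector [(s 1, ..., s j)]. *)
Definition prefix (R : realType) (s : nat -> R) (j : nat) : j.-tuple R :=
  [tuple s i.+1 | i < j].

(** The value at time [n >= 1] of the path [s 1, s 2, ...] stopped at the first
    index [k] with [s k <= a], written as a sum of increments: the [j]-th
    increment counts only if the path has stayed above [a] up to time [j]. *)
Definition stopped (R : realType) (a : R) (s : nat -> R) (n : nat) : R :=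
  (s 1%N + \sum_(1 <= j < n) (s j.+1 - s j) * \1_(above a j) (prefix s j))%R.

Lemma aboveS (R : realType) (a : R) (s : nat -> R) (n : nat) :
  above a n.+1 (prefix s n.+1) <->
  above a n (prefix s n) /\ (a < s n.+1)%R.
Proof.
split=> [h|[h hn] i].
  split=> [i|]; last by have := h ord_max; rewrite tnth_mktuple.
  by have := h (widen_ord (leqnSn n) i); rewrite !tnth_mktuple.
rewrite tnth_mktuple; have [->//|ni] := eqVneq i ord_max.
have lti : (i < n)%N by rewrite ltn_neqAle -ltnS ltn_ord andbT.
by have := h (Ordinal lti); rewrite tnth_mktuple.
Qed.

Lemma bigmin_prefix (R : realType) (a : R) (s : nat -> R) (n : nat) :
  (0 < n)%N ->
  (\big[Order.min/s 1%N]_(1 <= k < n.+1) s k <= a)%R <->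
  ~ above a n (prefix s n).
Proof.
move=> n0; rewrite big_add1 big_mkord leNgt; split.
- move=> /negP h A; apply: h; apply/bigmin_gtP; split=> [|i _].
  + by have := A (Ordinal n0); rewrite tnth_mktuple.
  + by have := A i; rewrite tnth_mktuple.
- move=> h; apply/negP => /bigmin_gtP[_ A]; apply: h => i.
  by rewrite tnth_mktuple; exact: A.
Qed.

Lemma measurable_above (R : realType) (a : R) (j : nat) :
  measurable (above a j).
Proof.
have -> : above a j =
    \bigcap_(i in [set: 'I_j]) ((@tnth j R)^~ i @^-1` `]a, +oo[%classic).
  apply/seteqP; split=> x h i; first by rewrite /= in_itv/= andbT.
  by have := h i I; rewrite /= in_itv/= andbT.
apply: fin_bigcap_measurable; first exact: finite_finset.
move=> i _; rewrite -[X in measurable X]setTI.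
exact: measurable_tnth.
Qed.

Lemma above_nondecreasing (R : realType) (a : R) (j : nat) :
  componentwise_nondecreasing (\1_(above a j) : j.-tuple R -> R).
Proof.
move=> x y xy; rewrite !indicE ler_nat.
case: (boolP (x \in above a j)) => //; rewrite inE => ax.
by rewrite mem_set// => i; apply: lt_le_trans (ax i) (xy i).
Qed.

Lemma stopped1 (R : realType) (a : R) (s : nat -> R) : stopped a s 1 = s 1%N.
Proof. by rewrite /stopped big_geq// addr0. Qed.

Lemma stopped_recr (R : realType) (a : R) (s : nat -> R) (n : nat) :
  stopped a s n.+2 =
  (stopped a s n.+1 +
   (s n.+2 - s n.+1) * \1_(above a n.+1) (prefix s n.+1))%R.
Proof. by rewrite /stopped big_nat_recr//= addrA. Qed.

Lemma stopped_above (R : realType) (a : R) (s : nat -> R) (n : nat) :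
  above a n.+1 (prefix s n.+1) -> stopped a s n.+1 = s n.+1.
Proof.
elim: n => [_|n IH /aboveS[A _]]; first exact: stopped1.
by rewrite stopped_recr IH// indicE mem_set// mulr1 subrKC.
Qed.

Lemma stopped_le (R : realType) (a : R) (s : nat -> R) (n : nat) :
  ~ above a n.+1 (prefix s n.+1) -> (stopped a s n.+1 <= a)%R.
Proof.
elim: n => [|n IH] /aboveS/not_andP h.
  rewrite stopped1.
  (* The empty prefix is vacuously above [a]. *)
  by case: h => [[]|/negP]; [case | rewrite -leNgt].
rewrite stopped_recr indicE.
have [|/negP] := boolP (prefix s n.+1 \in above a n.+1).
  rewrite inE => A; rewrite mulr1 stopped_above// subrKC.
  by case: h => [//|/negP]; rewrite -leNgt.
by rewrite inE => A; rewrite mulr0 addr0 IH.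
Qed.

Lemma norm_funrpos_le (T : Type) (R : realType) (f : T -> R) (w : T) :
  (`|f^\+ w| <= `|f w|)%R.
Proof. by rewrite ger0_norm ?funrpos_ge0// /funrpos ge_max ler_norm/=. Qed.

Lemma Lfun1_dominated (d : measure_display) (T : measurableType d)
    (R : realType) (P : probability T R) (f g : T -> R) :
  measurable_fun [set: T] f -> (forall w, `|f w| <= `|g w|)%R ->
  g \in Lfun P 1 -> f \in Lfun P 1.
Proof.
move=> mf fg /Lfun1_integrable ig; apply/Lfun1_integrable.
apply: le_integrable ig => //; first exact/measurable_EFinP.
by move=> w _; rewrite /= lee_fin.
Qed.

Lemma Lfun1_funrpos (d : measure_display) (T : measurableType d)
    (R : realType) (P : probability T R) (f : T -> R) :
  f \in Lfun P 1 -> (f^\+)%R \in Lfun P 1.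
Proof.
move=> fL; have /Lfun1_integrable/measurable_int/measurable_EFinP mf := fL.
apply: Lfun1_dominated fL; first exact: measurable_funrpos.
by move=> w; exact: norm_funrpos_le.
Qed.

(** Monotonicity of the expectation for integrable variables of any sign. *)
Lemma Lfun1_expectation_le (d : measure_display) (T : measurableType d)
    (R : realType) (P : probability T R) (f g : T -> R) :
  f \in Lfun P 1 -> g \in Lfun P 1 ->
  (forall w, f w <= g w)%R -> 'E_P[f] <= 'E_P[g].
Proof.
move=> /Lfun1_integrable fi /Lfun1_integrable gi fg; rewrite unlock.
by apply: le_integral => // w _; rewrite lee_fin.
Qed.

Section stopped_demisubmartingale.
Context (d : measure_display) (T : measurableType d) (R : realType)
  (P : probability T R) (S : nat -> {RV P >-> R}) (a : R).

Let path w : nat -> R := fun k => S k w.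

Lemma measurable_prefix_above (j : nat) :
  measurable [set w | above a j (prefix (path w) j)].
Proof.
rewrite -[X in measurable X]setTI.
have mp : measurable_fun [set: T] (fun w => prefix (path w) j).
  apply/measurable_fun_tnthP => i.
  apply: eq_measurable_fun (measurable_funPT (S i.+1)) => w _ /=.
  by rewrite tnth_mktuple.
exact: mp measurableT _ (@measurable_above R a j).
Qed.

Let incr j w : R :=
  ((S j.+1 w - S j w) * \1_(above a j) (prefix (path w) j))%R.

Lemma Lfun1_stopped_increment (j : nat) :
  demisubmartingale S -> (0 < j)%N -> incr j \in Lfun P 1.
Proof.
move=> hS j0; apply: (@Lfun1_dominated _ _ _ _ _ (S j.+1 \- S j)%R).
- apply: measurable_funM; first exact: measurable_funB.
  exact: measurable_indic (measurable_prefix_above j).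
- move=> w; rewrite normrM ler_piMr//= indicE normr_nat lern1.
  exact: leq_b1.
- by rewrite rpredB// hS.1.
Qed.

Lemma expectation_stopped_increment_ge0 (j : nat) :
  demisubmartingale S -> (0 < j)%N -> 0 <= 'E_P[incr j].
Proof.
move=> hS j0; apply: hS.2 => //.
- exact: measurable_indic (@measurable_above R a j).
- exact: above_nondecreasing.
- left; rewrite ltey_eq expectation_fin_num//.
  exact/Lfun1_funrpos/Lfun1_stopped_increment.
Qed.

Let stoppedSS (n : nat) : (fun w => stopped a (path w) n.+2) =
  ((fun w => stopped a (path w) n.+1) \+ incr n.+1)%R.
Proof. by apply/funext => w; rewrite stopped_recr. Qed.

Lemma Lfun1_stopped (n : nat) : demisubmartingale S ->
  (fun w => stopped a (path w) n.+1) \in Lfun P 1.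
Proof.
move=> hS; elim: n => [|n IH].
  by under eq_fun do rewrite stopped1; exact: hS.1.
by rewrite stoppedSS rpredD// Lfun1_stopped_increment.
Qed.

Lemma le_expectation_stopped (n : nat) : demisubmartingale S ->
  'E_P[S 1%N] <= 'E_P[fun w => stopped a (path w) n.+1].
Proof.
move=> hS; elim: n => [|n IH].
  by under [in leRHS]eq_fun do rewrite stopped1.
rewrite stoppedSS expectationD ?Lfun1_stopped ?Lfun1_stopped_increment//.
by rewrite -[leLHS]adde0 leeD// expectation_stopped_increment_ge0.
Qed.

End stopped_demisubmartingale.

Unset Implicit Arguments.
Set Strict Implicit.

Theorem theorem4p1 (d : measure_display) (T : measurableType d) (R : realType)
    (P : probability T R) (S : nat -> {RV P >-> R})
    (hS : demisubmartingale S) (n : nat) (hn : (1 <= n)%N)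
    (lambda : R) (hlambda : (0 < lambda)%R) :
  P [set w | (\big[Order.min/S 1%N w]_(1 <= k < n.+1) S k w <= - lambda)%R]
    <= ('E_P[(S n)^\+] - 'E_P[S 1%N]) / lambda%:E.
Proof.
case: n hn => [//|n] _.
pose path w k := S k w.
set B := [set w | _].
have BE : B = ~` [set w | above (- lambda) n.+1 (prefix (path w) n.+1)].
  by apply/seteqP; split=> w /(bigmin_prefix (- lambda) (path w) (ltn0Sn n)).
have mB : measurable B.
  by rewrite BE; apply: measurableC; exact: measurable_prefix_above.
have S1L : (S 1%N : T -> R) \in Lfun P 1 by exact: hS.1.
have posL : (S n.+1)^\+%R \in Lfun P 1 by exact/Lfun1_funrpos/hS.1.
have indL : (\1_B : T -> R) \in Lfun P 1.
  by apply/Lfun1_integrable; exact: integrable_indic.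
have lindL : (lambda \o* \1_B)%R \in Lfun P 1 by exact: Lfun_scale.
have EY_le : 'E_P[fun w => stopped (- lambda) (path w) n.+1] <=
    'E_P[((S n.+1)^\+ \- lambda \o* \1_B)%R].
  apply: Lfun1_expectation_le; [exact: Lfun1_stopped | exact: rpredB |].
  move=> w /=; rewrite indicE.
  have [|/negP] := boolP (w \in B); rewrite inE BE /= => A.
    by rewrite mul1r (le_trans (stopped_le A))// lerDr funrpos_ge0.
  by rewrite mul0r subr0 stopped_above ?le_max ?lexx//; exact: contrapT.
have := le_trans (le_expectation_stopped (- lambda) n hS) EY_le.
rewrite expectationB// expectationZl// expectation_indic//.
(* All the quantities are finite, so the inequality can be rearranged in [R]. *)
rewrite -(fineK (expectation_fin_num S1L)) -(fineK (expectation_fin_num posL)).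
rewrite -(fineK (fin_num_measure P _ mB)).
rewrite -EFinM -!EFinB inver gt_eqF// -EFinM !lee_fin ler_pdivlMr//.
by move=> h; lra.
Qed.
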